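(* Let $(R,\mathfrak m)$ be a Noetherian local ring which is a quotient of a regular local ring. Then there exist $s\geq 1$ and a non-zero minimal periodic (of period $2s$) co-chain complex $\mathbb F$ of finitely generated free $R$-modules (i.e. $\mathbb F\cong\mathbb F[2s]$) such that $H^i(\mathbb F)$ has finite length for all $i$. If $R$ is regular or if the residue field of $R$ is infinite, one can choose $s=1$. In this case there exists a non-zero minimal complex $\mathbb G$ of finitely generated free $R$-modules with $\mathbb G=\mathbb G[2]$ and such that $H^i(\mathbb G)$ has finite length for all $i\in\mathbb Z$.
   Context: Complexes are indexed cohomologically by $\mathbb Z$ and may be unbounded in both directions. A co-chain complex $\mathbb F\colon\cdots\to F^i\xrightarrow{d^i}F^{i+1}\to\cdots$ of finitely generated free $R$-modules is minimal if $d^i(F^i)\subseteq\mathfrak mF^{i+1}$ for all $i$. $\mathbb F[n]$ is the shift of $\mathbb F$ by $n$ (so $\mathbb F[n]^i=F^{i+n}$), and $\cong$ means isomorphism of complexes. *)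

(* Defs.v *)
From HB Require Import structures.
From mathcomp Require Import all_boot all_order all_algebra.
From mathcomp Require Import boolp classical_sets cardinality.

Set Implicit Arguments.
Unset Strict Implicit.
Unset Printing Implicit Defensive.

Import GRing.Theory.
Local Open Scope ring_scope.

Definition generates (R : nzRingType) (V : lmodType R) (n : nat)
    (g : 'I_n -> V) (N : {pred V}) : Prop :=
  forall x, x \in N <-> exists c : 'I_n -> R, x = \sum_(i < n) c i *: g i.

Definition min_ngens (R : nzRingType) (V : lmodType R) (N : {pred V})
    (d : nat) : Prop :=
  (exists g : 'I_d -> V, generates g N) /\
  (forall (n : nat) (g : 'I_n -> V), generates g N -> (d <= n)%N).

Definition strict_sub (T : Type) (A B : {pred T}) : Prop :=
  {subset A <= B} /\ ~ {subset B <= A}.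

(* M has finite length: the lengths l of the strictly increasing chains
   N_0 < N_1 < ... < N_l of submodules of M are bounded. *)
Definition finite_length (R : nzRingType) (M : lmodType R) : Prop :=
  exists b : nat, forall (l : nat) (N : 'I_l.+1 -> submodClosed M),
    (forall i j : 'I_l.+1, (i < j)%N -> strict_sub (N i) (N j)) -> (l <= b)%N.

(* I V, the submodule of V generated by the products a *: x, a in I, x in V. *)
Definition in_ideal_mul (R : nzRingType) (I : {pred R}) (V : lmodType R)
    (v : V) : Prop :=
  exists (n : nat) (a : 'I_n -> R) (x : 'I_n -> V),
    (forall k, a k \in I) /\ v = \sum_(k < n) a k *: x k.

Section QuotientModule.
Local Open Scope quotient_scope.
Variables (R : nzRingType) (V : lmodType R) (N : submodClosed V).

(* A copy of N carrying stability under opposites, which the quotient of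
   zmodTypes requires and which the structure submodClosed leaves implicit. *)
Definition quot_ker : V -> bool := fun x => x \in N.

Fact quot_ker_submod : subsemimod_closed quot_ker.
Proof. exact: (GRing.subsemimodClosedP N). Qed.

HB.instance Definition _ := GRing.isSubmodClosed.Build R V quot_ker
  quot_ker_submod.

Local Notation Q := (Quotient.quot (Algebra.ZmodClosed.clone V quot_ker _)).

Definition quot_mod : Type := Q.

HB.instance Definition _ := GRing.Zmodule.on quot_mod.

Definition quot_scale (a : R) (x : quot_mod) : quot_mod :=
  \pi_Q (a *: repr (x : Q)).

Fact quot_scale_pi (a : R) (v : V) :
  quot_scale a (\pi_Q v) = \pi_Q (a *: v).
Proof.
apply/eqP; rewrite -Quotient.idealrBE -scalerBr.
by apply: rpredZ; rewrite Quotient.idealrBE reprK.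
Qed.

Fact quot_scaleA (a b : R) (x : quot_mod) :
  quot_scale a (quot_scale b x) = quot_scale (a * b) x.
Proof. by rewrite quot_scale_pi scalerA. Qed.

Fact quot_scale1 : left_id 1 quot_scale.
Proof. by move=> x; rewrite /quot_scale scale1r reprK. Qed.

Fact quot_scaleDr : right_distributive quot_scale +%R.
Proof.
move=> a x y; rewrite -[x](@reprK _ Q).
rewrite -[y](@reprK _ Q).
rewrite !quot_scale_pi -!(raddfD (\pi_Q)).
by rewrite quot_scale_pi scalerDr.
Qed.

Fact quot_scaleDl (x : quot_mod) : {morph quot_scale^~ x : a b / a + b}.
Proof.
move=> a b; rewrite -[x](@reprK _ Q) !quot_scale_pi.
by rewrite scalerDl raddfD.
Qed.

HB.instance Definition _ := GRing.Zmodule_isLmodule.Build R quot_mod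
  quot_scaleA quot_scale1 quot_scaleDr quot_scaleDl.

End QuotientModule.

(* The elements of idealr R are the proper ideals of R; the unit ideal is
   always finitely generated, so it may be left out here. *)
Definition noetherian (R : comNzRingType) : Prop :=
  forall I : idealr R, exists (n : nat) (g : 'I_n -> R^o), generates g I.

(* I ranges over the proper ideals. *)
Definition maximal_ideal (R : comNzRingType) (m : idealr R) : Prop :=
  forall I : idealr R, {subset m <= I} -> {subset I <= m}.

Definition local_ring (R : comNzRingType) (m : idealr R) : Prop :=
  maximal_ideal m /\ forall I : idealr R, maximal_ideal I -> I =i m.

Definition has_prime_chain (R : comNzRingType) (l : nat) : Prop :=
  exists P : 'I_l.+1 -> prime_idealr R,
    forall i j : 'I_l.+1, (i < j)%N -> strict_sub (P i) (P j).

Definition krull_dim (R : comNzRingType) (d : nat) : Prop :=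
  has_prime_chain R d /\ forall l, has_prime_chain R l -> (l <= d)%N.

(* Regular: the least number of generators of m is the Krull dimension of R. *)
Definition regular_local_ring (R : comNzRingType) (m : idealr R) : Prop :=
  [/\ noetherian R, local_ring m &
      exists d : nat, krull_dim R d /\ @min_ngens R R^o m d].

Definition quotient_of_regular (R : comNzRingType) : Prop :=
  exists (S : comNzRingType) (n : idealr S) (f : {rmorphism S -> R}),
    regular_local_ring n /\ forall y : R, exists x : S, f x = y.

Definition infinite_residue_field (R : comNzRingType) (m : idealr R) : Prop :=
  infinite_set [set: {ideal_quot m}].

(* A vectType R is an R-module with a linear bijection to some 'rV[R]_n, i.e.
   a finitely generated free R-module.  The differential d^i is diff i (i + 1);
   diff i j is defined for all i and j, and is 0 unless j = i + 1, so that no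
   transport along equations between indices is needed. *)
Record complex (R : comNzRingType) := Complex {
  obj :> int -> vectType R;
  diff : forall i j : int, 'Hom(obj i, obj j);
  diff_shape : forall i j : int, j != i + 1 -> diff i j = 0;
  diff_comp : forall i j k : int, (diff j k \o diff i j)%VF = 0
}.

Section Complexes.
Variable R : comNzRingType.

Section Shift.
Variables (F : complex R) (n : int).

Definition shift_obj (i : int) : vectType R := F (i + n).

Definition shift_diff (i j : int) : 'Hom(shift_obj i, shift_obj j) :=
  (-1) ^+ `|n|%N *: diff F (i + n) (j + n).

Fact shift_diff_shape (i j : int) : j != i + 1 -> shift_diff i j = 0.
Proof.
move=> neq_ji; rewrite /shift_diff diff_shape ?scaler0 //.
by rewrite addrAC (inj_eq (addIr n)).
Qed.

Fact shift_diff_comp (i j k : int) :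
  (shift_diff j k \o shift_diff i j)%VF = 0.
Proof. by rewrite -comp_lfunZl -comp_lfunZr diff_comp !scaler0. Qed.

(* F[n]: F[n]^i = F^(i + n), with differential (-1)^n d. *)
Definition shift : complex R := Complex shift_diff_shape shift_diff_comp.
End Shift.

Definition chain_map (F G : complex R) (f : forall i, 'Hom(F i, G i)) : Prop :=
  forall i j : int, (diff G i j \o f i = f j \o diff F i j)%VF.

Definition complex_iso (F G : complex R) : Prop :=
  exists (f : forall i, 'Hom(F i, G i)) (g : forall i, 'Hom(G i, F i)),
    [/\ chain_map f, chain_map g, (forall i, (g i \o f i = \1)%VF) &
        forall i, (f i \o g i = \1)%VF].

Definition nonzero (F : complex R) : Prop :=
  exists (i : int) (x : F i), x != 0.

Definition minimal (m : {pred R}) (F : complex R) : Prop :=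
  forall (i : int) (x : F i), in_ideal_mul m (diff F i (i + 1) x).

Section Cohomology.
Variables (F : complex R) (i : int).

Definition cocycle_pred : F i -> bool := fun x => diff F i (i + 1) x == 0.

Fact cocycle_submod : subsemimod_closed cocycle_pred.
Proof.
have inE' x : (x \in cocycle_pred) = (diff F i (i + 1) x == 0) by [].
split; first split; first by rewrite inE' linear0.
  by move=> x y; rewrite !inE' linearD /= => /eqP-> /eqP->; rewrite addr0.
by move=> a x; rewrite !inE' linearZ /= => /eqP->; rewrite scaler0.
Qed.

HB.instance Definition _ := GRing.isSubmodClosed.Build R (F i) cocycle_pred
  cocycle_submod.

(* Z^i, the kernel of d^i. *)
Record cocycle :=
  Cocycle { cocycle_val :> F i; _ : cocycle_val \in cocycle_pred }.

HB.instance Definition _ := [isSub for cocycle_val].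
HB.instance Definition _ := [Choice of cocycle by <:].
HB.instance Definition _ := [SubChoice_isSubLmodule of cocycle by <:].

(* B^i, the image of d^(i-1), as a submodule of Z^i. *)
Definition coboundary_pred : cocycle -> bool :=
  fun z => `[< exists y : F (i - 1), diff F (i - 1) i y = val z >].

Fact coboundary_submod : subsemimod_closed coboundary_pred.
Proof.
have inE' z : (z \in coboundary_pred)
  = `[< exists y : F (i - 1), diff F (i - 1) i y = val z >] by [].
split; first split.
- by rewrite inE'; apply/asboolP; exists 0; rewrite linear0.
- move=> z1 z2; rewrite !inE' => /asboolP[y1 e1] /asboolP[y2 e2].
  by apply/asboolP; exists (y1 + y2); rewrite linearD /= e1 e2.
- move=> a z; rewrite !inE' => /asboolP[y e].
  by apply/asboolP; exists (a *: y); rewrite linearZ /= e.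
Qed.

HB.instance Definition _ := GRing.isSubmodClosed.Build R cocycle
  coboundary_pred coboundary_submod.

Definition cohomology : lmodType R := quot_mod (GRing.SubmodClosed.clone R cocycle coboundary_pred _).
End Cohomology.

End Complexes.

(* Main.v *)
(* Let x_1, ..., x_r generate m, and let D be the differential of the Koszul
   complex K on the x_i, regarded as an endomorphism of the free module
   V = K_0 + ... + K_r.  The complex ... -> V -> V -> V -> ... with all
   differentials equal to D is minimal.  Its cohomology is finitely generated,
   R being noetherian, and it is killed by every x_i, because multiplication by
   x_i is homotopic to zero on K; so it is a finite dimensional vector space
   over the residue field.  Since the shift by 2 does not change the sign of
   the differential, this complex is equal to its shift by 2. *)
From HB Require Import structures.
Require Import Defs.
From mathcomp Require Import all_boot all_order all_algebra.
From mathcomp Require Import boolp.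

Set Implicit Arguments.
Unset Strict Implicit.
Unset Printing Implicit Defensive.

Import GRing.Theory.
Local Open Scope ring_scope.

(** * Residue fields and finite length of modules killed by a maximal ideal *)

(** Without such a [b], the ideal [m + Ra] would not contain 1, hence would be proper; maximality
    would then put [a] in [m]. *)
Lemma maximal_ideal_inv (R : comNzRingType) (m : idealr R) (a : R) :
  maximal_ideal m -> a \notin m -> exists b, 1 - b * a \in m.
Proof.
move=> max_m am; apply: contrapT => no_inv.
pose I : R -> bool := fun x => `[< exists b, x - b * a \in m >].
have inI x : (x \in I) = `[< exists b, x - b * a \in m >] by [].
have I_ideal : idealr_closed I.
  split.
      by rewrite inI; apply/asboolP; exists 0; rewrite mul0r subr0 rpred0.
    by rewrite inI; apply/asboolP.
  move=> c x y; rewrite !inI => /asboolP[b bx] /asboolP[d dy].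
  apply/asboolP; exists (c * b + d).
  by rewrite mulrDl opprD addrACA -mulrA -mulrBr rpredD ?idealMr.
pose J : idealr R := HB.pack I (isIdealr.Build R I I_ideal).
suff: a \in m by rewrite (negPf am).
apply: (max_m J).
  by move=> x xm; rewrite inI; apply/asboolP; exists 0; rewrite mul0r subr0.
by rewrite inI; apply/asboolP; exists 1; rewrite mul1r subrr rpred0.
Qed.

Section ResidueField.
Local Open Scope quotient_scope.

(** The quotient is packed as a [fieldType] so that matrix rank is available; only the kernel and
    the surjectivity of [f] matter afterwards. *)
Lemma residue_field (R : comNzRingType) (m : idealr R) :
  maximal_ideal m -> exists (K : fieldType) (f : {rmorphism R -> K}),
    (forall a, (f a == 0) = (a \in m)) /\ forall y, exists x, f x = y.
Proof.
move=> max_m; pose Q := {ideal_quot m}.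
have pi0 a : (\pi_Q a == 0) = (a \in m).
  by rewrite -[0](rmorph0 (\pi_Q)) -Quotient.idealrBE subr0.
have /choice[inv invP] (x : Q) :
    exists y : Q, if x == 0 then y = 0 else y * x = 1.
  case: eqP => [_|/eqP]; first by exists 0.
  rewrite -[x](@reprK _ Q) pi0 => /(maximal_ideal_inv max_m)[b bP].
  exists (\pi_Q b); apply/eqP; rewrite -rmorphM -(rmorph1 (\pi_Q)) eq_sym.
  by rewrite -Quotient.idealrBE.
have mulVf (x : Q) : x != 0 -> inv x * x = 1.
  by move=> x0; have := invP x; rewrite (negPf x0).
have inv0 : inv 0 = 0 by have := invP 0; rewrite eqxx.
pose K : fieldType := HB.pack Q (GRing.ComNzRing_isField.Build Q mulVf inv0).
exists K, (\pi_Q : {rmorphism R -> Q}); split=> [a|y]; first exact: pi0.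
by exists (repr (y : Q)); apply: (@reprK _ Q).
Qed.

End ResidueField.

(** [M] is a vector space over the residue field spanned by [n] vectors, so [n] bounds the chains: a
    longer one would yield more than [n] independent vectors. *)
Lemma fg_residue_finite_length (R : comNzRingType) (m : idealr R)
    (M : lmodType R) (n : nat) (g : 'I_n -> M) :
  maximal_ideal m -> (forall a (x : M), a \in m -> a *: x = 0) ->
  (forall x, exists c : 'I_n -> R, x = \sum_(i < n) c i *: g i) ->
  finite_length M.
Proof.
move=> max_m mM0 gP; exists n => l N Nlt; rewrite leqNgt; apply/negP => lt_nl.
have [K [f [f0 f_surj]]] := residue_field max_m.
have Nle (i j : 'I_l.+1) : (i <= j)%N -> {subset N i <= N j}.
  rewrite leq_eqVlt => /orP[/eqP/val_inj-> //|/Nlt[] //].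
have /choice[v vP] (i : 'I_l) :
    exists x, x \in N (lift ord0 i) /\ x \notin N (widen_ord (leqnSn l) i).
  have [//|_ nsub] := Nlt (widen_ord (leqnSn l) i) (lift ord0 i).
  apply: contrapT => no_x; apply: nsub => x xN.
  by apply: contrapT => /negP xN'; apply: no_x; exists x.
have /choice[A AP] i := gP (v i).
pose fA : 'M[K]_(l, n) := \matrix_(i, j) f (A i j).
(* The [l] rows lie in a space of dimension [n < l], so some nonzero [u] is a linear relation
   between them. *)
have: kermx fA != 0.
  rewrite -mxrank_eq0 mxrank_ker subn_eq0 -ltnNge.
  by rewrite (leq_ltn_trans (rank_leq_col _)).
move=> /rowV0Pn[u /sub_kermxP uA /rV0Pn[i0 u0]].
have /choice[c cP] i := f_surj (u 0 i).
have cA j : \sum_i c i * A i j \in m.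
  rewrite -f0 rmorph_sum; apply/eqP; transitivity ((u *m fA) 0 j).
    by rewrite mxE; apply: eq_bigr => i _; rewrite mxE rmorphM cP.
  by rewrite uA mxE.
have cv0 : \sum_i c i *: v i = 0.
  transitivity (\sum_j (\sum_i c i * A i j) *: g j).
    under eq_bigr do rewrite AP scaler_sumr.
    rewrite exchange_big; apply: eq_bigr => j _; rewrite scaler_suml.
    by apply: eq_bigr => i _; rewrite scalerA.
  by apply: big1 => j _; apply: mM0.
(* Take the last index [i] with [u 0 i] nonzero. Terms after [i] have coefficients in [m] and
   vanish; those before lie in the [i]-th submodule, and so does [c i *: v i]. *)
case: (@arg_maxnP _ i0 (fun i => u 0 i != 0) val u0) => i ui max_i.
have [viN viN'] := vP i.
have civi : c i *: v i \in N (widen_ord (leqnSn l) i).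
  move/eqP: cv0; rewrite (bigD1 i) //= addr_eq0 => /eqP->; rewrite -scaleN1r.
  apply: rpredZ; apply: rpred_sum => k neq_ki.
  have [uk0|uk] := eqVneq (u 0 k) 0.
    by rewrite mM0 ?rpred0 // -f0 cP uk0.
  apply: rpredZ; apply: (Nle (lift ord0 k)); last by have [] := vP k.
  by rewrite lift0 /= ltn_neqAle neq_ki; apply: max_i.
(* [b] inverts [c i] modulo [m], so [v i = b * c i *: v i] falls into the submodule that it was
   chosen to avoid. *)
have [b fb] := f_surj (u 0 i)^-1.
move/negP: viN'; apply.
have /(mM0 _ (v i))/eqP : 1 - b * c i \in m.
  by rewrite -f0 rmorphB rmorph1 rmorphM fb cP mulVf ?subrr.
rewrite scalerBl scale1r subr_eq0 => /eqP->.
by rewrite -scalerA rpredZ.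
Qed.

(** * Finite generation over a noetherian ring *)

(** [noetherian] speaks of proper ideals only; the unit ideal is generated by 1. *)
Lemma noetherian_fg (R : comNzRingType) (I : R -> Prop) :
  noetherian R -> I 0 -> (forall a x y, I x -> I y -> I (a * x + y)) ->
  exists (n : nat) (g : 'I_n -> R),
    forall x, I x <-> exists c : 'I_n -> R, x = \sum_(i < n) c i * g i.
Proof.
move=> noethR I0 ID; have [I1|nI1] := pselect (I 1).
  exists 1%N, (fun=> 1) => x; split=> [_|_].
    by exists (fun=> x); rewrite big_ord1 mulr1.
  by rewrite -[x]addr0 -[x]mulr1; apply: ID.
have J_ideal : idealr_closed (fun x => `[< I x >]).
  split; rewrite ?unfold_in; try exact/asboolP.
  move=> a x y; rewrite !unfold_in => /asboolP Ix /asboolP Iy.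
  exact/asboolP/ID.
pose J : idealr R := HB.pack (fun x => `[< I x >]) (isIdealr.Build R _ J_ideal).
have [n [g gP]] := noethR J; exists n, g => x.
by rewrite -gP unfold_in; split=> /asboolP.
Qed.

(** Induction on [n]: the first coordinates of [N] form an ideal, and the elements with first
    coordinate 0 form a submodule of rank [n] rows. Lifted generators of the former and generators
    of the latter together generate [N]. *)
Lemma submodule_fg (R : comNzRingType) (n : nat) (N : 'rV[R]_n -> Prop) :
  noetherian R -> N 0 -> (forall a x y, N x -> N y -> N (a *: x + y)) ->
  exists (r : nat) (g : 'I_r -> 'rV[R]_n),
    forall x, N x <-> exists c : 'I_r -> R, x = \sum_(i < r) c i *: g i.
Proof.
move=> noethR; elim: n N => [|n IHn]; last rewrite -[n.+1]/(1 + n)%N;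
  move=> N N0 ND.
  exists 0%N, (fun=> 0) => x; rewrite (thinmx0 x).
  by split=> // _; exists (fun=> 0); rewrite big_ord0.
have NS r (g : 'I_r -> 'rV_(1 + n)) c : (forall i, N (g i)) ->
    N (\sum_(i < r) c i *: g i).
  move=> Ng; apply: (big_ind N) => // [x y Nx Ny|i _].
    by rewrite -[x]scale1r; apply: ND.
  by rewrite -[_ *: _]addr0; apply: ND.
have [r [g gP]] : exists (r : nat) (g : 'I_r -> R), forall a,
    (exists y : 'rV_n, N (row_mx a%:M y)) <->
    exists c : 'I_r -> R, a = \sum_(i < r) c i * g i.
  apply: noetherian_fg => //.
    by exists 0; rewrite raddf0 row_mx0.
  move=> a x y [x' Nx] [y' Ny]; exists (a *: x' + y').
  suff -> : row_mx (a * x + y)%:M (a *: x' + y')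
      = a *: row_mx x%:M x' + row_mx y%:M y' :> 'rV_(1 + n) by apply: ND.
  by rewrite scale_row_mx add_row_mx raddfD /= scale_scalar_mx.
have [s [h hP]] : exists (s : nat) (h : 'I_s -> 'rV_n), forall y,
    N (row_mx 0 y) <->
    exists c : 'I_s -> R, y = \sum_(i < s) c i *: h i.
  apply: IHn; first by rewrite row_mx0.
  move=> a x y Nx Ny; have := ND a _ _ Nx Ny.
  by rewrite scale_row_mx add_row_mx scaler0 addr0.
have /choice[g' g'P] i : exists y : 'rV_n, N (row_mx (g i)%:M y).
  (* Kronecker coefficients show that the generator [g i] itself belongs to the ideal. *)
  apply/gP; exists (fun j => (j == i)%:R).
  rewrite (bigD1 i) //= eqxx mul1r big1 ?addr0 // => j /negPf->.
  by rewrite mul0r.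
pose G (k : 'I_(r + s)) : 'rV_(1 + n) :=
  match split k with
  | inl i => row_mx (g i)%:M (g' i) | inr j => row_mx 0 (h j) end.
have NG k : N (G k).
  rewrite /G; case: split => // j; apply/hP; exists (fun i => (i == j)%:R).
  rewrite (bigD1 j) //= eqxx scale1r big1 ?addr0 // => i /negPf->.
  by rewrite scale0r.
exists (r + s)%N, G => x; split=> [Nx|[c ->]]; last exact: NS.
have [c ec] : exists c : 'I_r -> R, lsubmx x 0 0 = \sum_(i < r) c i * g i.
  by apply/gP; exists (rsubmx x); rewrite -mx11_scalar hsubmxK.
(* [x'] has the same first coordinate as [x], so [x - x'] is a combination of the [h j]. *)
pose x' := \sum_(i < r) c i *: row_mx (g i)%:M (g' i).
have ex' : lsubmx (x - x') = 0.
  rewrite linearB linear_sum /= [lsubmx x]mx11_scalar ec raddf_sum.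
  apply/eqP; rewrite subr_eq0; apply/eqP/eq_bigr => i _.
  by rewrite scale_row_mx row_mxKl scale_scalar_mx.
have Nx' : N (x - x').
  rewrite addrC -scaleN1r; apply: ND => //; exact: NS.
have [d ed] : exists d : 'I_s -> R,
    rsubmx (x - x') = \sum_(i < s) d i *: h i.
  by apply/hP; rewrite -ex' hsubmxK.
exists (fun k => match split k with inl i => c i | inr j => d j end).
rewrite big_split_ord /=.
under eq_bigr do rewrite /G (unsplitK (inl _)).
under [X in _ + X]eq_bigr do
  rewrite /G (unsplitK (inr _)) scale_row_mx scaler0.
apply/eqP; rewrite addrC -subr_eq; apply/eqP.
rewrite -[LHS](@hsubmxK _ _ 1) ex' ed.
elim/big_ind2: _ => //; first by rewrite row_mx0.
by move=> y1 _ y2 _ <- <-; rewrite add_row_mx addr0.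
Qed.

(** * The Koszul differential as a square-zero matrix *)

(* [D] is the total Koszul differential on [xs], built as an iterated mapping
   cone; [h] is the multiplication by the basis vector attached to [x]. *)
Lemma koszul_matrix (R : comNzRingType) (xs : seq R) :
  exists (n : nat) (D : 'M[R]_n),
    [/\ (0 < n)%N, D *m D = 0,
        forall I : idealr R, {subset xs <= I} -> forall i j, D i j \in I &
        forall x, x \in xs -> exists h, D *m h + h *m D = x%:M].
Proof.
elim: xs => [|x xs [n [D [n0 D2 Dm Dh]]]].
  by exists 1%N, 0; split=> [//||I _ i j|//]; rewrite ?mul0mx // mxE rpred0.
exists (n + n)%N, (block_mx D x%:M 0 (- D)).
split=> [||I xsI i j|y].
- by rewrite addn_gt0 n0.
- rewrite mulmx_block !(mul0mx, mulmx0, mul_mx_scalar, mul_scalar_mx).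
  rewrite mulmxN mulNmx D2 scalerN !oppr0 !addr0 subrr.
  exact: block_mx0.
- have xI : x \in I by apply: xsI; rewrite mem_head.
  have DI k l : D k l \in I.
    by apply: Dm => z zs; apply: xsI; rewrite inE zs orbT.
  rewrite -[i]splitK -[j]splitK.
  case: split => k; case: split => l.
  + by rewrite block_mxEul.
  + by rewrite block_mxEur mxE rpredMn.
  + by rewrite block_mxEdl mxE rpred0.
  + by rewrite block_mxEdr mxE rpredN.
rewrite inE => /orP[/eqP->|/Dh[h hP]].
(* For the new element [x], the homotopy is the identity between the two copies of the module in the
   cone. *)
- exists (block_mx 0 0 1%:M 0).
  rewrite !mulmx_block !(mul0mx, mulmx0, mul1mx, mulmx1).
  rewrite !(add0r, addr0) add_block_mx.
  by rewrite !(add0r, addr0) addNr scalar_mx_block.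
(* The sign on the second copy makes the off-diagonal blocks [- x h] and [x h] cancel. *)
- exists (block_mx h 0 0 (- h)).
  rewrite !mulmx_block !(mul0mx, mulmx0).
  rewrite !(add0r, addr0) add_block_mx.
  rewrite !mulmxN !mulNmx !opprK mul_mx_scalar mul_scalar_mx addNr addr0.
  by rewrite hP scalar_mx_block.
Qed.

(** * Equality and isomorphism of complexes *)

(** The last two fields are propositions, hence proof irrelevant. This gives the strict equality
    with the shift, beyond isomorphism. *)
Lemma Complex_eq (R : comNzRingType) (V : int -> vectType R)
    (d d' : forall i j : int, 'Hom(V i, V j)) sd sd' cd cd' :
  d = d' -> @Complex R V d sd cd = @Complex R V d' sd' cd'.
Proof.
move=> eq_d; case: d' / eq_d sd' cd' => sd' cd'.
by rewrite (Prop_irrelevance sd sd') (Prop_irrelevance cd cd').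
Qed.

Lemma complex_iso_refl (R : comNzRingType) (F : complex R) : complex_iso F F.
Proof.
exists (fun=> \1%VF), (fun=> \1%VF).
by split=> [i j|i j|i|i]; rewrite ?comp_lfun1l ?comp_lfun1r.
Qed.

(** * The projection onto a quotient module as a linear map *)

Section QuotientProjection.
Local Open Scope quotient_scope.
Variables (R : nzRingType) (V : lmodType R) (N : submodClosed V).

Definition quot_proj (v : V) : quot_mod N :=
  \pi_(Quotient.quot (Algebra.ZmodClosed.clone V (quot_ker N) _)) v.

Fact quot_proj_linear : linear quot_proj.
Proof.
move=> a v w; rewrite /quot_proj raddfD; congr (_ + _).
exact: (esym (@quot_scale_pi R V N a v)).
Qed.

HB.instance Definition _ :=
  GRing.isLinear.Build R V (quot_mod N) *:%R quot_proj quot_proj_linear.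

Lemma quot_proj_surj (x : quot_mod N) : exists v, quot_proj v = x.
Proof.
pose Q := Quotient.quot (Algebra.ZmodClosed.clone V (quot_ker N) _).
by exists (repr (x : Q)); apply: (@reprK _ Q).
Qed.

Lemma quot_proj_eq0 (v : V) : (quot_proj v == 0) = (v \in N).
Proof. by rewrite -(raddf0 quot_proj) -Quotient.idealrBE subr0. Qed.

End QuotientProjection.

(** * The complex with the same free module and the same differential in every degree *)

Section ConstComplex.
Variables (R : comNzRingType) (n : nat) (D : 'M[R]_n).
Hypothesis D2 : D *m D = 0.

Definition const_diff (i j : int) : 'Hom('rV[R]_n, 'rV[R]_n) :=
  if j == i + 1 then linfun (mulmxr D) else 0.

Lemma const_diff_shape (i j : int) : j != i + 1 -> const_diff i j = 0.
Proof. by rewrite /const_diff => /negPf->. Qed.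

Lemma const_diff_comp (i j k : int) :
  (const_diff j k \o const_diff i j)%VF = 0.
Proof.
rewrite /const_diff; case: ifP => _; last by rewrite comp_lfun0l.
case: ifP => _; last by rewrite comp_lfun0r.
by apply/lfunP => v; rewrite comp_lfunE !lfunE /= -mulmxA D2 mulmx0.
Qed.

Definition const_complex : complex R :=
  @Complex R (fun=> 'rV[R]_n) const_diff const_diff_shape const_diff_comp.

Lemma const_complexE (i j : int) (v : 'rV[R]_n) :
  j = i + 1 -> diff const_complex i j v = v *m D.
Proof. by move=> ->; rewrite /= /const_diff eqxx lfunE. Qed.

(** The objects on both sides are convertible, the sign is [(-1) ^+ 2 = 1], and [j + 2 = i + 2 + 1]
    amounts to [j = i + 1]. *)
Lemma const_complex_shift2 : const_complex = shift const_complex 2%:Z.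
Proof.
apply: Complex_eq; apply: functional_extensionality_dep => i.
apply: functional_extensionality_dep => j.
rewrite /shift_diff /= /const_diff expr2 mulrNN mulr1 scale1r.
by rewrite addrAC (inj_eq (addIr _)).
Qed.

Lemma const_complex_minimal (I : idealr R) :
  (forall i j, D i j \in I) -> minimal I const_complex.
Proof.
move=> DI i v; rewrite const_complexE //.
exists n, (fun k => (v *m D) 0 k), (fun k => delta_mx 0 k); split=> [k|].
  by rewrite mxE; apply: rpred_sum => j _; apply: idealMr.
exact: row_sum_delta.
Qed.

(** The kernel of [D] is a submodule of a free module of finite rank; the classes of its generators
    generate the cohomology. *)
Lemma const_cohomology_fg (i : int) : noetherian R ->
  exists (r : nat) (g : 'I_r -> cohomology const_complex i),
    forall x, exists c : 'I_r -> R, x = \sum_(k < r) c k *: g k.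
Proof.
move=> noethR.
have [r [g gP]] : exists (r : nat) (g : 'I_r -> 'rV[R]_n), forall v,
    v *m D = 0 <-> exists c : 'I_r -> R, v = \sum_(k < r) c k *: g k.
  apply: submodule_fg => //; first exact: mul0mx.
  by move=> a v w vD wD; rewrite mulmxDl -scalemxAl vD wD scaler0 addr0.
have /choice[z zP] k : exists z : cocycle const_complex i, val z = g k.
  have gk : g k \in @cocycle_pred R const_complex i.
    rewrite unfold_in /cocycle_pred const_complexE //; apply/eqP/gP.
    exists (fun l => (l == k)%:R); rewrite (bigD1 k) //= eqxx scale1r.
    by rewrite big1 ?addr0 // => l /negPf->; rewrite scale0r.
  by exists (Cocycle gk).
exists r, (fun k => quot_proj _ (z k)) => x.
have [y <-] := quot_proj_surj x.
have [c yc] : exists c : 'I_r -> R, val y = \sum_(k < r) c k *: g k.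
  by apply/gP; rewrite -(@const_complexE i (i + 1)) //; apply/eqP; case: y.
exists c; under eq_bigr do rewrite -linearZ; rewrite -linear_sum /=.
congr (quot_proj _ _); apply: val_inj; rewrite yc linear_sum /=.
by apply: eq_bigr => k _; rewrite zP.
Qed.

(** Vectors are rows: for a cocycle [z], [a *: z = z *m D *m h + z *m h *m D = (z *m h) *m D], a
    coboundary. *)
Lemma const_cohomology_annihilated (i : int) (h : 'M[R]_n) (a : R)
    (x : cohomology const_complex i) :
  D *m h + h *m D = a%:M -> a *: x = 0.
Proof.
move=> hP; have [z <-] := quot_proj_surj x.
apply/eqP; rewrite -linearZ quot_proj_eq0; apply/asboolP.
exists (val z *m h).
have zD : val z *m D = 0.
  rewrite -(@const_complexE i (i + 1)) //.
  by apply/eqP; case: z.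
rewrite const_complexE ?subrK //.
rewrite linearZ /= -mul_mx_scalar -hP mulmxDr !mulmxA zD mul0mx.
by rewrite add0r.
Qed.

End ConstComplex.

Theorem theorem1p11 (R : comNzRingType) (m : idealr R) :
  noetherian R -> local_ring m -> quotient_of_regular R ->
  (exists s : nat, (1 <= s)%N /\
     exists F : complex R,
       [/\ nonzero F, minimal m F, complex_iso F (shift F (2 * s)%:Z) &
           forall i : int, finite_length (cohomology F i)]) /\
  (regular_local_ring m \/ infinite_residue_field m ->
     (exists F : complex R,
       [/\ nonzero F, minimal m F, complex_iso F (shift F 2%:Z) &
           forall i : int, finite_length (cohomology F i)]) /\
     (exists G : complex R,
       [/\ nonzero G, minimal m G, G = shift G 2%:Z &
           forall i : int, finite_length (cohomology G i)])).
Proof.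
move=> noethR [max_m _] _.
(* The equality of [G] with its shift by 2 also gives the required isomorphisms, with [s = 1]. *)
have [G [G0 Gmin Gper Gfl]] : exists G : complex R,
    [/\ nonzero G, minimal m G, G = shift G 2%:Z &
        forall i : int, finite_length (cohomology G i)].
  have [r [g gP]] : exists (r : nat) (g : 'I_r -> R), forall x, x \in m <->
      exists c : 'I_r -> R, x = \sum_(k < r) c k * g k.
    apply: noetherian_fg => //; first exact: rpred0.
    by move=> a x y xm ym; rewrite rpredD ?idealMr.
  have gm k : g k \in m.
    apply/gP; exists (fun l => (l == k)%:R); rewrite (bigD1 k) //= eqxx mul1r.
    by rewrite big1 ?addr0 // => l /negPf->; rewrite mul0r.
  have [n [D [n0 D2 Dm Dh]]] := koszul_matrix (codom g).
  exists (const_complex D2); split.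
  (* The all-ones row is nonzero because [n] is positive. *)
  - exists 0, (const_mx 1); apply/negP => /eqP e.
    have := congr1 (fun v : 'rV_n => v 0 (Ordinal n0)) e.
    by move=> /eqP; rewrite !mxE oner_eq0.
  - by apply: const_complex_minimal => i j; apply: Dm => _ /codomP[k ->].
  - exact: const_complex_shift2.
  move=> i; have [s [h hP]] := const_cohomology_fg D2 i noethR.
  (* Each generator [g k] of [m] kills cohomology by its Koszul homotopy, hence so does every
     element of [m]. *)
  apply: (fg_residue_finite_length max_m _ hP) => a x /gP[c ->].
  rewrite scaler_suml big1 // => k _; rewrite -scalerA.
  have [h' h'P] := Dh (g k) (codom_f g k).
  by rewrite (const_cohomology_annihilated x h'P) scaler0.
have Giso : complex_iso G (shift G 2%:Z).
  by rewrite -Gper; apply: complex_iso_refl.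
by split; first exists 1%N; split=> //; exists G.
Qed.
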